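(* Assume the standing setup in the context, and assume one of the sample times equals $0$, so that $x^*(0)$ is a column of $\Lambda_0$. Then the optimal solution set of (P1) and the feasible set of (P2) coincide under the following correspondences. (i) If $(\hat A,\hat B,\hat Q,\hat R,\hat P)$ is an optimal solution of (P1), set $Z=\hat A^\top\hat P$ and $M=\hat A-\hat BK^*$. Then $(Z,\hat Q,\hat R,\hat P,M)$ is feasible for (P2). (ii) Conversely, let $(Z,\hat Q,\hat R,\hat P,M)$ be feasible for (P2), and set $\hat A=\hat P^{-1}Z^\top$ and $\hat B=\hat P^{-1}K^{*\top}\hat R$. Then $(\hat A,\hat B,\hat Q,\hat R,\hat P)$ is an optimal solution of (P1), with objective value $0$ and $\hat R^{-1}\hat B^\top\hat P=K^*$.
   Context: Standing setup. The true system is given by $A\in\mathbb{R}^{n\times n}$ and $B\in\mathbb{R}^{n\times m}$, with $(A,B)$ stabilizable. The true weights are $Q$, symmetric positive semidefinite, and $R$, symmetric positive definite, with $(A,Q^{1/2})$ detectable. $P$ is the unique symmetric positive definite (stabilizing) solution of $A^\top P+PA-PBR^{-1}B^\top P+Q=0$. Set $K^*=R^{-1}B^\top P$ and $A_K^*=A-BK^*$. The expert trajectory is $x^*(t)=e^{A_K^*t}x^*(0)$ for $t\in[0,T]$, with $T>0$. Fix $\epsilon>0$. Problem (P1): minimize, over $\hat A\in\mathbb{R}^{n\times n}$, $\hat B\in\mathbb{R}^{n\times m}$ and symmetric $\hat Q,\hat R,\hat P$ (of sizes $n,m,n$), the objective $J=\|\hat K-K^*\|_2^2+\int_0^T\|\hat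 x(t)-x^*(t)\|_2^2\,dt$, subject to the following constraints: - $\hat A^\top\hat P+\hat P\hat A-\hat P\hat B\hat R^{-1}\hat B^\top\hat P+\hat Q=0$; - $\hat K=\hat R^{-1}\hat B^\top\hat P$; - $\hat x(t)=e^{(\hat A-\hat B\hat K)t}x^*(0)$; - $\hat Q\succeq0$, $\hat R\succeq\epsilon I$, $\hat P\succeq\epsilon I$. Data matrices: fix sample times $t_1,\dots,t_N\in[0,T]$. Let $x^{*(i)}$ denote the $i$-th derivative of $x^*$, and set $\Lambda_i=[x^{*(i)}(t_1)\cdots x^{*(i)}(t_N)]$ for $i=0,\dots,n$. Define $\bar\Lambda_1=[\Lambda_0\cdots\Lambda_{n-1}]$ and $\bar\Lambda_2=[\Lambda_1\cdots\Lambda_n]$. Problem (P2), a feasibility problem: find $Z\in\mathbb{R}^{n\times n}$, $M\in\mathbb{R}^{n\times n}$ and symmetric $\hat Q,\hat R,\hat P$ such that - $Z^\top+Z-K^{*\top}\hat RK^*+\hat Q=0$; - $Z^\top-K^{*\top}\hat RK^*=\hat PM$; - $M\bar\Lambda_1=\bar\Lambda_2$; - $\hat Q\succeq0$, $\hat R\succeq\epsilon I$, $\hat P\succeq\epsilon I$. *)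

(* Defs.v *)
From HB Require Import structures.
From mathcomp Require Import all_boot all_order all_algebra.
From mathcomp Require Import all_classical all_reals all_analysis.
From mathcomp Require Import complex.
Set Implicit Arguments. Unset Strict Implicit. Unset Printing Implicit Defensive.
Import Order.TTheory GRing.Theory Num.Theory numFieldNormedType.Exports.
Local Open Scope ring_scope.
Local Open Scope classical_set_scope.

Definition symmx {R : realType} {n : nat} (M : 'M[R]_n) : Prop := M^T = M.

Definition psd {R : realType} {n : nat} (M : 'M[R]_n) : Prop :=
  forall x : 'cV[R]_n, 0 <= (x^T *m M *m x) 0 0.

Definition pd {R : realType} {n : nat} (M : 'M[R]_n) : Prop :=
  forall x : 'cV[R]_n, x != 0 -> 0 < (x^T *m M *m x) 0 0.

Definition mxge_scal {R : realType} {n : nat} (M : 'M[R]_n) (e : R) : Prop :=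
  psd (M - e%:M).

Definition expm {R : realType} {n : nat} (A : 'M[R]_n) : 'M[R]_n :=
  limn (series (fun k : nat => (k`!%:R)^-1 *: A ^+ k)).

Definition hurwitz {R : realType} {n : nat} (A : 'M[R]_n) : Prop :=
  forall z : R[i], root (map_poly (real_complex R) (char_poly A)) z ->
    complex.Re z < 0.

Definition stabilizable {R : realType} {n m : nat}
  (A : 'M[R]_n) (B : 'M[R]_(n, m)) : Prop :=
  exists K : 'M[R]_(m, n), hurwitz (A - B *m K).

Definition detectable {R : realType} {n p : nat}
  (A : 'M[R]_n) (C : 'M[R]_(p, n)) : Prop :=
  exists L : 'M[R]_(n, p), hurwitz (A - L *m C).

Definition care {R : realType} {n m : nat} (A : 'M[R]_n) (B : 'M[R]_(n, m))
  (Q : 'M[R]_n) (Rw : 'M[R]_m) (P : 'M[R]_n) : Prop :=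
  A^T *m P + P *m A - P *m B *m invmx Rw *m B^T *m P + Q = 0.

Definition gain {R : realType} {n m : nat} (B : 'M[R]_(n, m)) (Rw : 'M[R]_m)
  (P : 'M[R]_n) : 'M[R]_(m, n) := invmx Rw *m B^T *m P.

Definition traj {R : realType} {n : nat} (F : 'M[R]_n) (x0 : 'cV[R]_n)
  (t : R) : 'cV[R]_n := expm (t *: F) *m x0.

Definition vnorm2 {R : realType} {n : nat} (x : 'cV[R]_n) : R :=
  \sum_(i < n) x i 0 ^+ 2.

Definition specnorm2 {R : realType} {m n : nat} (M : 'M[R]_(m, n)) : R :=
  sup [set vnorm2 (M *m x) | x in [set x : 'cV[R]_n | vnorm2 x <= 1]].

(* constraints of (P1) (K^ and x^ are determined by the other variables) *)
Definition P1_feasible {R : realType} {n m : nat} (eps : R)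
  (Ah : 'M[R]_n) (Bh : 'M[R]_(n, m)) (Qh : 'M[R]_n) (Rh : 'M[R]_m)
  (Ph : 'M[R]_n) : Prop :=
  [/\ symmx Qh, symmx Rh, symmx Ph, care Ah Bh Qh Rh Ph &
      [/\ psd Qh, mxge_scal Rh eps & mxge_scal Ph eps]].

Definition P1_obj {R : realType} {n m : nat} (Ks : 'M[R]_(m, n))
  (xs : R -> 'cV[R]_n) (T : R)
  (Ah : 'M[R]_n) (Bh : 'M[R]_(n, m)) (Rh : 'M[R]_m) (Ph : 'M[R]_n) : \bar R :=
  let Kh := gain Bh Rh Ph in
  let xh := traj (Ah - Bh *m Kh) (xs 0) in
  let D : set R := `[0, T] in
  ((specnorm2 (Kh - Ks))%:E +
   \int[lebesgue_measure]_(t in D) (vnorm2 (xh t - xs t))%:E)%E.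

Definition P1_optimal {R : realType} {n m : nat} (eps : R) (Ks : 'M[R]_(m, n))
  (xs : R -> 'cV[R]_n) (T : R)
  (Ah : 'M[R]_n) (Bh : 'M[R]_(n, m)) (Qh : 'M[R]_n) (Rh : 'M[R]_m)
  (Ph : 'M[R]_n) : Prop :=
  P1_feasible eps Ah Bh Qh Rh Ph /\
  forall (A' : 'M[R]_n) (B' : 'M[R]_(n, m)) (Q' : 'M[R]_n) (R' : 'M[R]_m)
         (P' : 'M[R]_n),
    P1_feasible eps A' B' Q' R' P' ->
    (P1_obj Ks xs T Ah Bh Rh Ph <= P1_obj Ks xs T A' B' R' P')%E.

Definition Lambda {R : realType} {n N : nat} (xs : R -> 'cV[R]_n)
  (ts : 'I_N -> R) (i : nat) : 'M[R]_(n, N) :=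
  \matrix_(k < n, j < N) (derive1n i xs (ts j)) k 0.

Definition Lbar1 {R : realType} {n N : nat} (xs : R -> 'cV[R]_n)
  (ts : 'I_N -> R) : 'M[R]_(n, \sum_(i < n) N) :=
  \mxrow_(i < n) Lambda xs ts i.

Definition Lbar2 {R : realType} {n N : nat} (xs : R -> 'cV[R]_n)
  (ts : 'I_N -> R) : 'M[R]_(n, \sum_(i < n) N) :=
  \mxrow_(i < n) Lambda xs ts i.+1.

Definition P2_feasible {R : realType} {n m N : nat} (eps : R)
  (Ks : 'M[R]_(m, n)) (xs : R -> 'cV[R]_n) (ts : 'I_N -> R)
  (Z M : 'M[R]_n) (Qh : 'M[R]_n) (Rh : 'M[R]_m) (Ph : 'M[R]_n) : Prop :=
  [/\ [/\ symmx Qh, symmx Rh & symmx Ph],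
      Z^T + Z - Ks^T *m Rh *m Ks + Qh = 0,
      Z^T - Ks^T *m Rh *m Ks = Ph *m M &
      [/\ M *m Lbar1 xs ts = Lbar2 xs ts,
          psd Qh, mxge_scal Rh eps & mxge_scal Ph eps]].

(* Main.v *)
Require Import Defs.
From HB Require Import structures.
From mathcomp Require Import all_boot all_order all_algebra.
From mathcomp Require Import all_classical all_reals all_analysis.
From mathcomp Require Import complex.
From mathcomp Require Import measurable_realfun.
From mathcomp Require Import ring lra.
Import Order.TTheory GRing.Theory Num.Theory numFieldNormedType.Exports.
Local Open Scope ring_scope.

(** The optimal value of (P1) is 0: with the true [A] and [B], a large multiple of
    [(Q, R, P)] is feasible and has the same gain [K*].  The objective vanishes exactly
    when the gain is [K*] and the two trajectories agree on [[0, T]], and the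
    latter means [M^k x*(0) = F^k x*(0)] for all [k], where [M] is the estimated
    and [F] the true closed-loop matrix (differentiate [k] times and let [t] tend
    to 0).  The data equations of (P2) say [M F^k x*(t_j) = F^(k+1) x*(t_j)] for
    [k < n]; taking [t_j = 0], the Cayley-Hamilton theorem extends them to all
    [k]. *)

Set Implicit Arguments. Unset Strict Implicit.
Unset Printing Implicit Defensive.

(** * Quadratic forms and the squared spectral norm *)

Section quadratic_forms.
Variable R : realType.

Lemma vnorm2E n (x : 'cV[R]_n) : vnorm2 x = (x^T *m x) 0 0.
Proof. by rewrite mxE; apply: eq_bigr => i _; rewrite mxE expr2. Qed.

Lemma vnorm2_ge0 n (x : 'cV[R]_n) : 0 <= vnorm2 x.
Proof. by apply: sumr_ge0 => i _; exact: sqr_ge0. Qed.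

Lemma vnorm2_0 n : vnorm2 (0 : 'cV[R]_n) = 0.
Proof. by apply: big1 => i _; rewrite mxE expr0n. Qed.

Lemma vnorm2_eq0 n (x : 'cV[R]_n) : vnorm2 x = 0 -> x = 0.
Proof.
move=> /eqP; rewrite psumr_eq0 => [/allP x0|i _]; last exact: sqr_ge0.
apply/matrixP => i j; rewrite ord1 !mxE; apply/eqP.
by rewrite -sqrf_eq0; apply: x0; rewrite mem_index_enum.
Qed.

Lemma ler_sqr_vnorm2 n (x : 'cV[R]_n) i : x i 0 ^+ 2 <= vnorm2 x.
Proof.
by rewrite /vnorm2 (bigD1 i) //= lerDl; apply: sumr_ge0 => j _; exact: sqr_ge0.
Qed.

Lemma quadform_ub n (M : 'M[R]_n) :
  exists2 C, 0 < C & forall x : 'cV_n, (x^T *m M *m x) 0 0 <= C * vnorm2 x.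
Proof.
(* The added 1 keeps the constant positive even for [M = 0], so that it can be inverted later. *)
exists (1 + \sum_j \sum_i `|M i j|) => [|x].
  by apply: ltr_pwDl => //; apply: sumr_ge0 => j _; apply: sumr_ge0.
rewrite mulrDl mul1r; apply: ler_wpDl; first exact: vnorm2_ge0.
rewrite mxE mulr_suml; apply: ler_sum => j _.
rewrite mxE !mulr_suml; apply: ler_sum => i _; rewrite mxE.
have hi := ler_sqr_vnorm2 x i; have hj := ler_sqr_vnorm2 x j.
(* Expanding [(x_i + x_j)^2] and [(x_i - x_j)^2] bounds [|x_i x_j|] by the mean of [x_i^2] and
   [x_j^2]. *)
have xx : `|x i 0 * x j 0| <= vnorm2 x.
  rewrite ler_norml.
  have := sqr_ge0 (x i 0 - x j 0); have := sqr_ge0 (x i 0 + x j 0); nra.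
rewrite -mulrA mulrCA.
by apply: (le_trans (ler_norm _)); rewrite normrM ler_wpM2l.
Qed.

(** A nonzero row in the left kernel of [M] would be a zero of the form. *)
Lemma pd_unitmx n (M : 'M[R]_n) : pd M -> M \in unitmx.
Proof.
move=> pM; apply: contraT; rewrite -row_free_unit -kermx_eq0 => /rowV0Pn[v].
move=> /sub_kermxP vM v0; have := pM v^T.
by rewrite trmxK vM mul0mx mxE ltxx trmx_eq0 => /(_ v0).
Qed.

(* Expand the form at [x - s M^-1 x] with [s = 1 / C], where [C] bounds the form
   of [M^-1]. *)
Lemma pd_coercive n (M : 'M[R]_n) : symmx M -> pd M ->
  exists2 C, 0 < C & forall x : 'cV_n, vnorm2 x <= C * (x^T *m M *m x) 0 0.
Proof.
move=> sM pM; have uM := pd_unitmx pM.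
have [C C0 leC] := quadform_ub (invmx M); exists C => // x.
set y := invmx M *m x; have Myx : M *m y = x by rewrite mulKVmx.
have yMx : y^T *m M = x^T by rewrite -[in LHS]sM -trmx_mul Myx.
have : 0 <= ((x - C^-1 *: y)^T *m M *m (x - C^-1 *: y)) 0 0.
  have [->|nz] := eqVneq (x - C^-1 *: y) 0; first by rewrite mulmx0 mxE.
  exact/ltW/pM.
rewrite [(x - _)^T]linearB /= [(_ *: y)^T]linearZ /= !mulmxBl !mulmxBr -!scalemxAl.
rewrite -!scalemxAr yMx.
rewrite -(mulmxA x^T M y) Myx scalerA.
have := leC x; rewrite -mulmxA -/y vnorm2E.
set a := x^T *m M *m x; set b := x^T *m y; set v := x^T *m x => leCx.
move: a b v leCx => a b v leCx; rewrite !mxE.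
have h1 : C^-1 * (C^-1 * b 0 0) <= C^-1 * v 0 0.
  by rewrite ler_wpM2l ?ler_pdivrMl// invr_ge0 ltW.
move=> h2; rewrite -ler_pdivrMl//; lra.
Qed.

Lemma mxge_scal_pd n (M : 'M[R]_n) e : 0 < e -> mxge_scal M e -> pd M.
Proof.
move=> e0 Me x x0; have := Me x.
have v0 : 0 < vnorm2 x.
  by rewrite lt_def vnorm2_ge0 andbT; apply: contra_neq x0; exact: vnorm2_eq0.
rewrite mulmxBr mulmxBl mul_mx_scalar -scalemxAl.
rewrite vnorm2E in v0; move: (x^T *m M *m x) (x^T *m x) v0 => a v v0.
by rewrite !mxE subr_ge0; apply: lt_le_trans; exact: mulr_gt0.
Qed.

(** Coercivity with constant [C] gives the threshold [e * C]. Allowing every larger scale lets one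
    common factor serve both the weight and the Riccati solution. *)
Lemma pd_scale_ge n (M : 'M[R]_n) e : symmx M -> pd M -> 0 < e ->
  exists2 c0, 0 < c0 & forall c, c0 <= c -> mxge_scal (c *: M) e.
Proof.
move=> sM pM e0; have [C C0 leC] := pd_coercive sM pM.
exists (e * C) => [|c ec x]; first exact: mulr_gt0.
have := leC x; rewrite mulmxBr mulmxBl mul_mx_scalar -scalemxAl.
rewrite -scalemxAr -scalemxAl; have := vnorm2_ge0 x; rewrite vnorm2E.
move: (x^T *m M *m x) (x^T *m x) => a v v0 va; rewrite !mxE subr_ge0.
apply: (le_trans (ler_wpM2l (ltW e0) va)); rewrite mulrA ler_wpM2r//.
(* The form is nonnegative because [C] times it dominates [vnorm2 x]; this includes [x = 0], about
   which [pd] says nothing. *)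
by rewrite -(pmulr_rge0 _ C0) (le_trans v0).
Qed.

(** The squared norm of [M *m x] is the form of [M^T *m M] at [x], hence bounded on the unit ball;
    [sup] of an unbounded set would be a default value. *)
Lemma has_sup_specnorm2 m n (M : 'M[R]_(m, n)) :
  has_sup [set vnorm2 (M *m x) | x in [set x : 'cV[R]_n | vnorm2 x <= 1]]%classic.
Proof.
split; first by exists (vnorm2 (M *m 0)), 0 => //=; rewrite vnorm2_0.
have [C C0 leC] := quadform_ub (M^T *m M).
exists C => _ [x /= x1 <-].
rewrite vnorm2E trmx_mul !mulmxA -[x^T *m _ *m _]mulmxA.
by apply: (le_trans (leC x)); rewrite ler_piMr// ltW.
Qed.

Lemma specnorm2_ub m n (M : 'M[R]_(m, n)) x :
  vnorm2 x <= 1 -> vnorm2 (M *m x) <= specnorm2 M.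
Proof.
by move=> x1; apply: ub_le_sup; [case: (has_sup_specnorm2 M)|exists x].
Qed.

Lemma specnorm2_ge0 m n (M : 'M[R]_(m, n)) : 0 <= specnorm2 M.
Proof.
by rewrite (le_trans (vnorm2_ge0 (M *m 0)))// specnorm2_ub// vnorm2_0.
Qed.

Lemma specnorm2_0 m n : specnorm2 (0 : 'M[R]_(m, n)) = 0.
Proof.
apply/eqP; rewrite eq_le specnorm2_ge0 andbT.
apply: ge_sup; first by case: (has_sup_specnorm2 (0 : 'M[R]_(m, n))).
by move=> _ [x _ <-]; rewrite mul0mx vnorm2_0.
Qed.

(** Basis vectors lie in the unit ball, so every column of [M] has norm 0. *)
Lemma specnorm2_eq0 m n (M : 'M[R]_(m, n)) : specnorm2 M = 0 -> M = 0.
Proof.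
move=> M0; apply/matrixP => i j.
have dj1 : vnorm2 (delta_mx j 0 : 'cV[R]_n) <= 1.
  rewrite /vnorm2 (bigD1 j)//= big1 => [|k /negPf kj].
    by rewrite !mxE !eqxx expr1n addr0.
  by rewrite mxE kj expr0n.
have /vnorm2_eq0 : vnorm2 (M *m delta_mx j 0) = 0.
  by apply/eqP; rewrite eq_le vnorm2_ge0 andbT -M0 specnorm2_ub.
by rewrite -colE => /matrixP/(_ i 0); rewrite !mxE.
Qed.

End quadratic_forms.

(** * The matrix exponential through scalar power series *)

Section exponential_series.
Local Open Scope classical_set_scope.
Variable R : realType.

(** The terms are dominated by those of [C exp(s |t|)]. *)
Lemma is_cvg_pseries_exp (u : R^nat) (C s t : R) :
  (forall k, `|u k| <= C * s ^+ k) ->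
  cvgn (pseries (fun k => u k / k`!%:R) t).
Proof.
move=> us; pose v k := C * exp_coeff (s * `|t|) k.
have uv k : `|u k / k`!%:R * t ^+ k| <= v k.
  rewrite /v /exp_coeff /= exprMn !normrM normrX normfV normr_nat.
  by rewrite mulrAC !mulrA ler_wpM2r ?invr_ge0// ler_wpM2r ?exprn_ge0.
apply: normed_cvg; apply: (@series_le_cvg _ _ v) => //=.
- by move=> k; apply: le_trans (uv k).
- exact: (is_cvg_seriesZ (is_cvg_series_exp_coeff _)).
Qed.

(** With the factorials in the coefficients, termwise differentiation is a shift of [u]. *)
Lemma is_derive_pseries_exp (u : R^nat) (C s t : R) :
  (forall k, `|u k| <= C * s ^+ k) ->
  is_derive t (1 : R) (fun t => limn (pseries (fun k => u k / k`!%:R) t))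
    (limn (pseries (fun k => u k.+1 / k`!%:R) t)).
Proof.
move=> us.
have dE (w : R^nat) : pseries_diffs (fun k => w k / k`!%:R) =
    (fun k => w k.+1 / k`!%:R).
  apply/funext => k; rewrite /pseries_diffs factS natrM invfM mulrCA.
  by rewrite mulVKf ?pnatr_eq0.
have us1 k : `|u k.+1| <= (C * s) * s ^+ k by rewrite -mulrA -exprS.
have us2 k : `|u k.+2| <= (C * s * s) * s ^+ k by rewrite -mulrA -exprS.
(* The series and its first two formal derivatives must converge at some point farther from 0 than
   [t]; both shifts of [u] keep a geometric bound. *)
rewrite -dE; apply: (@pseries_snd_diffs _ _ (`|t| + 1)); rewrite ?dE.
- exact: is_cvg_pseries_exp us.
- exact: is_cvg_pseries_exp us1.
- exact: (@is_cvg_pseries_exp (fun k => u k.+2) _ _ _ us2).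
- by rewrite [ltRHS]ger0_norm ?ltrDl// addr_ge0.
Qed.

Lemma cvg_mx_entries m n (u : nat -> 'M[R]_(m, n)) (l : 'M[R]_(m, n)) :
  (forall i j, (u k i j @[k --> \oo]) --> l i j) -> u @ \oo --> l.
Proof.
move=> ul; apply/cvgrPdist_le => /= e e0; near=> k.
rewrite [leLHS]/Num.Def.normr/= mx_normrE (bigmax_le _ (ltW e0))//= => i _.
rewrite !mxE/=; move: i; near: k; apply: filter_forall => /= i.
exact: ((cvgrPdist_le _ _).1 (ul i.1 i.2)).
Unshelve. all: by end_near. Qed.

(** The sum of all absolute entries dominates each row sum, so each further factor [F] costs at most
    that sum. *)
Lemma mxpow_entry_le n (F : 'M[R]_n) k i j :
  `|(F ^+ k) i j| <= (\sum_p \sum_q `|F p q|) ^+ k.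
Proof.
elim: k i j => [|k IH] i j.
  by rewrite !expr0 mxE; case: eqP => _; rewrite ?normr1// normr0.
rewrite exprS mxE (le_trans (ler_norm_sum _ _ _))// exprS mulr_suml.
rewrite [leRHS](bigD1 i)//= ler_wpDr//.
  apply: sumr_ge0 => p _.
  by rewrite mulr_ge0 ?exprn_ge0// ?sumr_ge0// => *; rewrite sumr_ge0.
by rewrite mulr_suml; apply: ler_sum => q _; rewrite normrM ler_wpM2l.
Qed.

(* [exprZn] needs a nontrivial ring, which excludes [n = 0]. *)
Lemma mxpowZ n (t : R) (F : 'M[R]_n) k : (t *: F) ^+ k = t ^+ k *: F ^+ k.
Proof.
elim: k => [|k IH]; first by rewrite !expr0 scale1r.
by rewrite !exprS IH -!mulmxE -scalemxAl -scalemxAr scalerA.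
Qed.

Lemma cvg_expm_entry n (F : 'M[R]_n) t i j :
  pseries (fun k => (F ^+ k) i j / k`!%:R) t @ \oo --> expm (t *: F) i j.
Proof.
have ce p q : cvgn (pseries (fun k => (F ^+ k) p q / k`!%:R) t).
  apply: (@is_cvg_pseries_exp _ 1) => k; rewrite mul1r; exact: mxpow_entry_le.
suff -> : expm (t *: F) =
    \matrix_(p, q) limn (pseries (fun k => (F ^+ k) p q / k`!%:R) t).
  by rewrite mxE; exact: ce.
apply/cvg_lim => //; apply: cvg_mx_entries => p q; rewrite mxE.
rewrite (_ : (fun k => _) = pseries (fun k => (F ^+ k) p q / k`!%:R) t).
  exact: ce.
apply/funext => k.
rewrite /series/= summxE; apply: eq_bigr => l _.
rewrite mxpowZ mxE [X in _ * X]mxE mulrCA [RHS]mulrC.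
by congr (_ * _); exact: mulrC.
Qed.

(** The left factor [G] covers at once the trajectory ([G = 1%:M]), its derivatives ([G = F ^+ k])
    and the residuals of the data equations. *)
Lemma cvg_traj n p (G : 'M[R]_(p, n)) (F : 'M[R]_n) (x0 : 'cV_n) t i :
  pseries (fun k => (G *m F ^+ k *m x0) i 0 / k`!%:R) t @ \oo -->
  (G *m traj F x0 t) i 0.
Proof.
rewrite /traj mulmxA mxE.
(* Each partial sum is a fixed linear combination of partial sums for the entries of the
   exponential. *)
have -> : pseries (fun k => (G *m F ^+ k *m x0) i 0 / k`!%:R) t =
  (fun N => \sum_j \sum_l
     G i l * x0 j 0 * pseries (fun k => (F ^+ k) l j / k`!%:R) t N).
  apply/funext => N; rewrite /pseries /series /=.
  under [RHS]eq_bigr => j _ do (under eq_bigr => l _ do rewrite mulr_sumr;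
    rewrite exchange_big /=).
  rewrite exchange_big /=; apply: eq_bigr => k _.
  rewrite mxE !mulr_suml; apply: eq_bigr => j _.
  by rewrite mxE !mulr_suml; apply: eq_bigr => l _; ring.
apply: cvg_big => [|j _]; first exact: add_continuous.
rewrite mxE mulr_suml; apply: cvg_big => [|l _]; first exact: add_continuous.
by rewrite mulrAC; apply: cvgMl_tmp; exact: cvg_expm_entry.
Qed.

Lemma traj_coef_le n p (G : 'M[R]_(p, n)) (F : 'M[R]_n) (x0 : 'cV_n) i k :
  `|(G *m F ^+ k *m x0) i 0| <=
  (\sum_j \sum_l `|G i l * x0 j 0|) * (\sum_p \sum_q `|F p q|) ^+ k.
Proof.
rewrite mxE (le_trans (ler_norm_sum _ _ _))// mulr_suml; apply: ler_sum => j _.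
rewrite mxE mulr_suml (le_trans (ler_norm_sum _ _ _))// mulr_suml.
apply: ler_sum => l _.
by rewrite mulrAC normrM ler_wpM2l// mxpow_entry_le.
Qed.

Lemma is_derive_traj n p (G : 'M[R]_(p, n)) (F : 'M[R]_n) (x0 : 'cV_n) t i :
  is_derive t (1 : R) (fun t => (G *m traj F x0 t) i 0)
    ((G *m F *m traj F x0 t) i 0).
Proof.
have E (H : 'M[R]_(p, n)) s : (H *m traj F x0 s) i 0 =
    limn (pseries (fun k => (H *m F ^+ k *m x0) i 0 / k`!%:R) s).
  by apply/esym/cvg_lim => //; exact: cvg_traj.
have -> : (fun t => (G *m traj F x0 t) i 0) =
    (fun t => limn (pseries (fun k => (G *m F ^+ k *m x0) i 0 / k`!%:R) t)).
  by apply/funext => s; exact: E.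
rewrite E.
have -> : (fun k => (G *m F *m F ^+ k *m x0) i 0 / k`!%:R) =
    (fun k => (G *m F ^+ k.+1 *m x0) i 0 / k`!%:R).
  by apply/funext => k; rewrite exprS -mulmxE !mulmxA.
apply: (@is_derive_pseries_exp (fun k => (G *m F ^+ k *m x0) i 0)) => k.
exact: traj_coef_le.
Qed.

Lemma continuous_traj n p (G : 'M[R]_(p, n)) (F : 'M[R]_n) (x0 : 'cV_n) i :
  continuous (fun t => (G *m traj F x0 t) i 0).
Proof.
move=> t; apply/differentiable_continuous/derivable1_diffP.
by have [] := is_derive_traj G F x0 t i.
Qed.

Lemma derive1n_traj n (F : 'M[R]_n) (x0 : 'cV_n) k t :
  derive1n k (traj F x0) t = F ^+ k *m traj F x0 t.
Proof.
elim: k t => [|k IH] t; first by rewrite expr0 mul1mx.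
rewrite derive1nS derive1E (funext IH) derive_mx; last first.
  apply/derivable_mxP => i j; rewrite ord1.
  by have [] := is_derive_traj (F ^+ k) F x0 t i.
apply/matrixP => i j; rewrite ord1 mxE.
rewrite (@derive_val _ _ _ _ _ _ _ (is_derive_traj (F ^+ k) F x0 t i)).
by rewrite exprSr.
Qed.

Lemma traj0 n (F : 'M[R]_n) (x0 : 'cV_n) : traj F x0 0 = x0.
Proof.
apply/matrixP => i j; rewrite ord1.
have := @cvg_traj _ _ 1%:M F x0 0 i; rewrite mul1mx => /cvg_lim <-//.
(* The partial sum of index 0 is empty; only from index 1 on is the sequence constant. *)
apply/cvg_lim => //; rewrite -cvg_shiftS.
rewrite (_ : [sequence _]_n = cst (x0 i 0)); first exact: cvg_cst.
apply/funext => N; rewrite /pseries /series /= big_nat_recl//=.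
rewrite big1 => [|k _]; last by rewrite expr0n mulr0.
by rewrite addr0 !expr0 !mul1mx fact0 divr1 mulr1.
Qed.

Lemma traj_eq n (F G : 'M[R]_n) (x0 : 'cV_n) t :
  (forall k, F ^+ k *m x0 = G ^+ k *m x0) -> traj F x0 t = traj G x0 t.
Proof.
move=> FG; apply/matrixP => i j; rewrite ord1.
have := @cvg_traj _ _ 1%:M F x0 t i; rewrite mul1mx => /cvg_lim <-//.
have := @cvg_traj _ _ 1%:M G x0 t i; rewrite mul1mx => /cvg_lim <-//.
by congr (limn (pseries _ t)); apply/funext => k; rewrite !mul1mx FG.
Qed.

Lemma mulmx_traj_eq0 n p (G : 'M[R]_(p, n)) (F : 'M[R]_n) (x0 : 'cV_n) t :
  (forall k, G *m F ^+ k *m x0 = 0) -> G *m traj F x0 t = 0.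
Proof.
move=> GF; apply/matrixP => i j; rewrite ord1 [RHS]mxE.
have /cvg_lim <-// := @cvg_traj _ _ G F x0 t i.
apply/cvg_lim => //; rewrite (_ : pseries _ _ = cst 0); first exact: cvg_cst.
by apply/funext => N; apply: big1 => k _ /=; rewrite GF mxE !mul0r.
Qed.

End exponential_series.

(** * Reduction of matrix powers by Cayley-Hamilton *)

Lemma horner_mx_sum (K : comNzRingType) n (F : 'M[K]_n.+1) (r : {poly K}) :
  horner_mx F r = \sum_(i < size r) r`_i *: F ^+ i.
Proof.
rewrite -[in LHS](coefK r) poly_def linear_sum; apply: eq_bigr => i _.
by rewrite linearZ/= rmorphXn/= horner_mx_X.
Qed.

(** The remainder of ['X^k] modulo the characteristic polynomial has degree below [n], so [F ^+ k]
    is a combination of the first [n] powers. *)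
Lemma mulmx_pow_eq0 (K : fieldType) n p (G : 'M[K]_(p, n)) (F : 'M[K]_n)
    (x0 : 'cV_n) :
  (forall k, (k < n)%N -> G *m F ^+ k *m x0 = 0) ->
  forall k, G *m F ^+ k *m x0 = 0.
Proof.
(* [horner_mx] lives in positive dimension; in dimension 0 the vector [x0] is empty. *)
case: n G F x0 => [G F x0 _ k|n G F x0 GF k].
  by rewrite [x0]flatmx0 mulmx0.
have -> : F ^+ k = horner_mx F ('X^k %% char_poly F).
  rewrite -[F in LHS]horner_mx_X -rmorphXn /= {1}(divp_eq 'X^k (char_poly F)).
  by rewrite rmorphD rmorphM /= Cayley_Hamilton mulr0 add0r.
rewrite horner_mx_sum mulmx_sumr mulmx_suml big1// => i _.
rewrite -scalemxAr -scalemxAl GF ?scaler0//.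
rewrite (leq_trans (ltn_ord i))// -ltnS -(size_char_poly F).
by rewrite ltn_modp monic_neq0// char_poly_monic.
Qed.

(** * Recovering powers from trajectories, and the data matrices *)

Section trajectories.
Local Open Scope classical_set_scope.
Variable R : realType.

(** A positive value at [t] forces [h > h t / 2] on an interval of length [e] around [t], so the
    integral would be at least [h t / 2 * e]. *)
Lemma continuous_integral_eq0 (h : R -> R) (a b : R) :
  continuous h -> (forall t, 0 <= h t) ->
  (\int[lebesgue_measure]_(t in `[a, b]) (h t)%:E = 0)%E ->
  forall t, a < t < b -> h t = 0.
Proof.
move=> ch h0 ih t /andP[at_ tb]; apply/eqP; apply: contraT => ht0.
have {}ht0 : 0 < h t by rewrite lt_def ht0 h0.
have : \forall s \near t, h t / 2 < h s /\ (a < s /\ s < b).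
  near=> s; split; last split.
  - near: s; apply: (cvgr_gt (h t)); first exact: ch.
    by rewrite ltr_pdivrMr// mulr_natr mulr2n ltrDl.
  - by near: s; exact: lt_nbhsr.
  - by near: s; exact: lt_nbhsl.
move=> /nbhs_ballP[e /= e0 he].
pose A : set R := `[t - e / 2, t + e / 2].
have Ae s : A s -> h t / 2 < h s /\ (a < s /\ s < b).
  rewrite /A /= in_itv/= => /andP[s1 s2]; apply: he.
  rewrite /ball/= ltr_distlC; apply/andP; split; lra.
have mh : measurable_fun (`[a, b] : set R) (EFin \o h).
  apply/measurable_EFinP; apply: (@measurable_funS _ _ _ _ setT) => //.
  exact: continuous_measurable_fun.
have mA : measurable A by exact: measurable_itv.
have muA : lebesgue_measure A = e%:E.
  rewrite /A lebesgue_measure_itv /= lte_fin ifT; last by lra.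
  by rewrite -EFinB; congr (_ %:E); lra.
have AD : A `<=` `[a, b].
  by move=> s /Ae[_ [h1 h2]]; rewrite /= in_itv/= !ltW.
have : ((h t / 2 * e)%:E <= \int[lebesgue_measure]_(s in `[a, b]) (h s)%:E)%E.
  apply: (@le_trans _ _ (\int[lebesgue_measure]_(s in A) (h s)%:E)%E).
    have -> : (h t / 2 * e)%:E =
        (\int[lebesgue_measure]_(s in A) (cst (h t / 2)%:E s))%E.
      by rewrite integral_cst// EFinM -muA.
    apply: ge0_le_integral => //=.
    - by move=> s _; rewrite lee_fin divr_ge0// ltW.
    - exact: measurable_funS mh.
    - by move=> s /Ae[/ltW + _]; rewrite lee_fin.
  by apply: ge0_subset_integral => // s _; rewrite lee_fin.
rewrite ih lee_fin leNgt => /negP[]; rewrite mulr_gt0// divr_gt0//.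
Unshelve. all: by end_near. Qed.

Lemma traj_eq_pow n (F G : 'M[R]_n) (x0 : 'cV_n) T : 0 < T ->
  (forall t, 0 < t < T -> traj F x0 t = traj G x0 t) ->
  forall k, F ^+ k *m x0 = G ^+ k *m x0.
Proof.
move=> T0 FG k.
have FGk t : 0 < t < T -> F ^+ k *m traj F x0 t = G ^+ k *m traj G x0 t.
  rewrite -!derive1n_traj; elim: k t => [|k IH] t; first exact: FG.
  move=> /andP[t0 tT].
  (* The interval is open, so the two [k]-th derivatives agree near [t] and have the same derivative
     there. *)
  rewrite !derive1nS !derive1E; apply: near_eq_derive; near=> s; apply: IH.
  apply/andP; split.
    by near: s; exact: lt_nbhsr.
  by near: s; exact: lt_nbhsl.
apply/matrixP => i j; rewrite ord1.
(* The limit is taken from the right because the agreement is known only for [t > 0]. *)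
have c0 (H : 'M[R]_n) :
    (H ^+ k *m traj H x0 t) i 0 @[t --> 0^'+] --> (H ^+ k *m x0) i 0.
  rewrite -{2}(traj0 H x0); apply: cvg_at_right_filter.
  exact: continuous_traj.
have /(@cvg_lim _ (@Rhausdorff R)) <- := c0 F.
apply: (@cvg_lim _ (@Rhausdorff R)).
have FG0 : \forall t \near 0^'+,
    (G ^+ k *m traj G x0 t) i 0 = (F ^+ k *m traj F x0 t) i 0.
  near=> t; rewrite FGk//.
  by apply/andP; split; near: t; [exact: nbhs_right_gt|exact: nbhs_right_lt].
exact: cvg_trans (near_eq_cvg FG0) (c0 G).
Unshelve. all: by end_near. Qed.

(** Column [j] of block [k] is a [k]-th derivative, that is, [F ^+ k] applied to the state at
    [ts j]. *)
Lemma mulmx_Lbar n N (F M : 'M[R]_n) (x0 : 'cV_n) (ts : 'I_N -> R) :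
  M *m Lbar1 (traj F x0) ts = Lbar2 (traj F x0) ts <->
  forall (k : 'I_n) j,
    M *m F ^+ k *m traj F x0 (ts j) = F ^+ k.+1 *m traj F x0 (ts j).
Proof.
have colL k j : col j (Lambda (traj F x0) ts k) = F ^+ k *m traj F x0 (ts j).
  by apply/matrixP => p q; rewrite ord1 !mxE derive1n_traj mxE.
have colM k j : col j (M *m Lambda (traj F x0) ts k) =
    M *m F ^+ k *m traj F x0 (ts j).
  by rewrite -mulmxA -colL !colE mulmxA.
rewrite /Lbar1 /Lbar2 mul_mxrow; split=> [/eq_mxrowP E k j|E].
  by rewrite -colM -colL E.
apply: eq_mxrow => k; apply/matrixP => p j.
have := E k j; rewrite -colM -colL => /matrixP/(_ p 0).
by rewrite mxE [RHS]mxE.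
Qed.

End trajectories.

(** * Zero objective in (P1) versus feasibility in (P2) *)

Section inverse_lqr.
Local Open Scope classical_set_scope.
Variables (R : realType) (n m : nat).

Lemma continuous_vnorm2_traj (F G : 'M[R]_n) (x0 : 'cV_n) :
  continuous (fun t => vnorm2 (traj F x0 t - traj G x0 t)).
Proof.
have c (H : 'M[R]_n) i : continuous (fun t => traj H x0 t i 0).
  move=> t; have := @continuous_traj _ _ _ 1%:M H x0 i t.
  by under eq_fun do rewrite mul1mx.
apply: (@continuous_big _ _ +%R) => [|i _ t]; first exact: add_continuous.
have -> : (fun t => (traj F x0 t - traj G x0 t) i 0 ^+ 2) =
    (fun t => (traj F x0 t i 0 - traj G x0 t i 0) ^+ 2).
  by apply/funext => s; rewrite !mxE.
by apply: cvgM; apply: cvgB; exact: c.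
Qed.

Lemma P1_obj_ge0 (Ks : 'M[R]_(m, n)) xs T Ah Bh Rh Ph :
  (0 <= P1_obj Ks xs T Ah Bh Rh Ph)%E.
Proof.
apply: adde_ge0; first by rewrite lee_fin specnorm2_ge0.
by apply: integral_ge0 => t _; rewrite lee_fin vnorm2_ge0.
Qed.

Lemma P1_obj_eq0P (F : 'M[R]_n) (x0 : 'cV_n) (Ks : 'M[R]_(m, n)) T Ah Bh Rh Ph :
  0 < T ->
  P1_obj Ks (traj F x0) T Ah Bh Rh Ph = 0%E <->
  gain Bh Rh Ph = Ks /\
  forall k, (Ah - Bh *m Ks) ^+ k *m x0 = F ^+ k *m x0.
Proof.
move=> T0; rewrite /P1_obj /= traj0; split=> [/eqP|[-> FG]]; last first.
  rewrite subrr specnorm2_0 add0e; apply: integral0_eq => t _.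
  by rewrite (traj_eq t FG) subrr vnorm2_0.
rewrite padde_eq0 ?lee_fin ?specnorm2_ge0//; last first.
  by apply: integral_ge0 => t _; rewrite lee_fin vnorm2_ge0.
move=> /andP[/eqP[/specnorm2_eq0/eqP]]; rewrite subr_eq0 => /eqP gE.
rewrite gE => /eqP i0; split=> //; apply: (traj_eq_pow T0) => t tT.
apply/eqP; rewrite -subr_eq0; apply/eqP/vnorm2_eq0.
apply: (continuous_integral_eq0 _ _ i0 tT); first exact: continuous_vnorm2_traj.
by move=> s; exact: vnorm2_ge0.
Qed.

(** The Riccati equation is homogeneous of degree 1 in [(Q, Rw, P)] and the gain of degree 0. *)
Lemma P1_feasible_scale (eps : R) A (B : 'M[R]_(n, m)) Q Rw P : 0 < eps ->
  symmx Q -> psd Q -> symmx Rw -> pd Rw -> symmx P -> pd P -> care A B Q Rw P ->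
  exists Q' R' P', P1_feasible eps A B Q' R' P' /\ gain B R' P' = gain B Rw P.
Proof.
move=> e0 sQ pQ sR pR sP pP cE.
have [c1 c10 hR] := pd_scale_ge sR pR e0.
have [c2 c20 hP] := pd_scale_ge sP pP e0.
pose c := c1 + c2; have c0 : 0 < c by exact: addr_gt0.
have cV : invmx (c *: Rw) = c^-1 *: invmx Rw.
  by rewrite invmxZ// unitmxZ ?pd_unitmx// unitfE gt_eqF.
exists (c *: Q), (c *: Rw), (c *: P); split; last first.
  rewrite /gain cV -scalemxAr -!scalemxAl scalerA divff ?gt_eqF//.
  by rewrite scale1r.
split; rewrite /symmx ?linearZ /= ?sQ ?sR ?sP //.
- rewrite /care cV -?scalemxAr -?scalemxAl -?scalemxAr -?scalemxAl !scalerA.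
  rewrite divfK ?gt_eqF// -scalerDr -scalerBr -scalerDr.
  by rewrite [X in _ *: X]cE scaler0.
- split; last 2 first.
  + by apply: hR; rewrite lerDl ltW.
  + by apply: hP; rewrite lerDr ltW.
  move=> x; rewrite -scalemxAr -scalemxAl mxE mulr_ge0 ?(ltW c0)//; exact: pQ.
Qed.

(** This is the change of variables behind (P2): with the gain fixed, [Ph *m Bh] becomes linear in
    [Rh]. *)
Lemma gain_tr (Bh : 'M[R]_(n, m)) Rh Ph :
  Rh \in unitmx -> symmx Rh -> symmx Ph -> (gain Bh Rh Ph)^T *m Rh = Ph *m Bh.
Proof.
move=> uR sR sP; rewrite /gain !trmx_mul trmxK trmx_inv sR sP -!mulmxA.
by rewrite mulVmx// mulmx1.
Qed.

Lemma P1_zero_P2 N (eps T : R) (F : 'M[R]_n) (x0 : 'cV_n) (ts : 'I_N -> R)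
    (Ks : 'M[R]_(m, n)) Ah Bh Qh Rh Ph :
  0 < T -> 0 < eps ->
  P1_feasible eps Ah Bh Qh Rh Ph ->
  P1_obj Ks (traj F x0) T Ah Bh Rh Ph = 0%E ->
  P2_feasible eps Ks (traj F x0) ts (Ah^T *m Ph) (Ah - Bh *m Ks) Qh Rh Ph.
Proof.
move=> T0 e0 [sQ sR sP cE [pQ gR gP]] /(P1_obj_eq0P _ _ _ _ _ _ _ T0)[gE powE].
have uR := pd_unitmx (mxge_scal_pd e0 gR).
have KR : Ks^T *m Rh = Ph *m Bh by rewrite -gE gain_tr.
have ZT : (Ah^T *m Ph)^T = Ph *m Ah by rewrite trmx_mul trmxK sP.
split=> //.
- rewrite ZT KR -[RHS]cE [Ph *m Ah + _]addrC; congr (_ - _ + _).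
  by rewrite -gE /gain !mulmxA.
- by rewrite ZT KR mulmxBr mulmxA.
split=> //; move: (Ah - Bh *m Ks) powE => M powE.
(* Replace [F ^+ l] by [M ^+ l] on [x0], absorb the extra [M], and go back to [F]. *)
have MF l : M *m F ^+ l *m x0 = F ^+ l.+1 *m x0.
  by rewrite -mulmxA -powE mulmxA [M *m _](esym (exprS M l)) powE.
apply/mulmx_Lbar => k j; apply/eqP; rewrite -subr_eq0 -mulmxBl; apply/eqP.
(* The residual [M F^k - F^(k+1)] kills every [F^l x0], hence the state at any sample time. *)
apply: mulmx_traj_eq0 => l.
rewrite !mulmxBl -(mulmxA M) [F ^+ k *m _](esym (exprD F k l)) MF.
by rewrite [F ^+ k.+1 *m _](esym (exprD F k.+1 l)) subrr.
Qed.

Lemma P2_P1_zero N (eps T : R) (F : 'M[R]_n) (x0 : 'cV_n) (ts : 'I_N -> R)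
    (Ks : 'M[R]_(m, n)) Z M Qh Rh Ph :
  0 < T -> 0 < eps -> (exists j, ts j = 0) ->
  P2_feasible eps Ks (traj F x0) ts Z M Qh Rh Ph ->
  let Ah := invmx Ph *m Z^T in
  let Bh := invmx Ph *m Ks^T *m Rh in
  [/\ P1_feasible eps Ah Bh Qh Rh Ph,
      P1_obj Ks (traj F x0) T Ah Bh Rh Ph = 0%E &
      gain Bh Rh Ph = Ks].
Proof.
move=> T0 e0 [j tj] [[sQ sR sP] ricE PM [LE pQ gR gP]] Ah Bh.
have uR := pd_unitmx (mxge_scal_pd e0 gR).
have uP := pd_unitmx (mxge_scal_pd e0 gP).
have BT : Bh^T = Rh *m Ks *m invmx Ph.
  by rewrite /Bh !trmx_mul trmxK trmx_inv sR sP mulmxA.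
have gE : gain Bh Rh Ph = Ks.
  by rewrite /gain BT -!mulmxA mulVmx// mulmx1 mulKmx.
have PB : Ph *m Bh = Ks^T *m Rh by rewrite /Bh -!mulmxA mulKVmx.
have PA : Ph *m Ah = Z^T by rewrite mulKVmx.
have AP : Ah^T *m Ph = Z by rewrite -[RHS]trmxK -PA [RHS]trmx_mul sP.
(* Cancelling [Ph] in the second constraint of (P2) identifies [M] as the estimated closed loop. *)
have ME : Ah - Bh *m Ks = M.
  apply: (can_inj (mulKmx uP)); by rewrite -PM mulmxBr PA mulmxA PB.
split=> //.
- split=> //; rewrite /care PA AP PB -[RHS]ricE [Z^T + Z]addrC.
  congr (_ - _ + _).
  by rewrite -!mulmxA (mulmxA (invmx Rh)) -/(gain Bh Rh Ph) gE.
- apply/(P1_obj_eq0P _ _ _ _ _ _ _ T0); split=> //; rewrite ME.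
  (* The sample at time 0 gives this for [k < n]. *)
  have MF k : (M - F) *m F ^+ k *m x0 = 0.
    apply: mulmx_pow_eq0 => {}k kn.
    have /mulmx_Lbar/(_ (Ordinal kn) j) := LE; rewrite tj traj0 /= => E.
    by rewrite !mulmxBl E exprS subrr.
  elim=> [|k IH]; first by rewrite !expr0.
  rewrite exprS -mulmxE -mulmxA IH mulmxA; apply/eqP.
  by rewrite -subr_eq0 exprS -mulmxE -!mulmxBl MF.
Qed.

End inverse_lqr.

Unset Implicit Arguments.

Theorem theorem1 (R : realType) (n m N : nat)
  (A : 'M[R]_n) (B : 'M[R]_(n, m)) (Q : 'M[R]_n) (Rw : 'M[R]_m)
  (Qsqrt : 'M[R]_n) (P : 'M[R]_n) (T eps : R) (x0 : 'cV[R]_n)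
  (ts : 'I_N -> R) :
  stabilizable A B ->
  symmx Q -> psd Q -> symmx Rw -> pd Rw ->
  symmx Qsqrt -> psd Qsqrt -> Qsqrt *m Qsqrt = Q -> detectable A Qsqrt ->
  symmx P -> pd P -> care A B Q Rw P -> hurwitz (A - B *m gain B Rw P) ->
  (forall P' : 'M[R]_n, symmx P' -> pd P' -> care A B Q Rw P' ->
     hurwitz (A - B *m gain B Rw P') -> P' = P) ->
  0 < T -> 0 < eps ->
  (forall j, 0 <= ts j <= T) -> (exists j, ts j = 0) ->
  let Ks := gain B Rw P in
  let xs := traj (A - B *m Ks) x0 in
  (forall (Ah : 'M[R]_n) (Bh : 'M[R]_(n, m)) (Qh : 'M[R]_n) (Rh : 'M[R]_m)
          (Ph : 'M[R]_n),
     P1_optimal eps Ks xs T Ah Bh Qh Rh Ph ->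
     P2_feasible eps Ks xs ts (Ah^T *m Ph) (Ah - Bh *m Ks) Qh Rh Ph) /\
  (forall (Z M : 'M[R]_n) (Qh : 'M[R]_n) (Rh : 'M[R]_m) (Ph : 'M[R]_n),
     P2_feasible eps Ks xs ts Z M Qh Rh Ph ->
     let Ah := invmx Ph *m Z^T in
     let Bh := invmx Ph *m Ks^T *m Rh in
     [/\ P1_optimal eps Ks xs T Ah Bh Qh Rh Ph,
         P1_obj Ks xs T Ah Bh Rh Ph = 0%E &
         gain Bh Rh Ph = Ks]).
Proof.
move=> _ sQ pQ sR pR _ _ _ _ sP pP cE _ _ T0 e0 _ t0 Ks xs; split.
  move=> Ah Bh Qh Rh Ph [feas opt]; apply: (P1_zero_P2 ts T0 e0 feas).
  have [Q' [R' [P' [feas' gE]]]] := P1_feasible_scale e0 sQ pQ sR pR sP pP cE.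
  apply/eqP; rewrite eq_le P1_obj_ge0 andbT.
  (* The bound 0 is rewritten as the value of the scaled true system, whose closed loop is the
     expert's own, so that optimality applies. *)
  have <- : P1_obj Ks xs T A B R' P' = 0%E.
    by apply/(P1_obj_eq0P _ _ _ _ _ _ _ T0); split; [exact: gE|move=> k].
  exact: opt feas'.
move=> Z M Qh Rh Ph P2 Ah Bh.
have [feas obj0 gE] := P2_P1_zero T0 e0 t0 P2.
split; [split; [exact: feas|]|exact: obj0|exact: gE].
by move=> A' B' Q' R' P' _; rewrite obj0; exact: P1_obj_ge0.
Qed.
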